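(* For every integer $k \geq 2$, there exists a Hamiltonian chordal graph with (vertex) connectivity exactly $k$ which is not fully cycle extendible.
   Context: All graphs are simple, finite, connected and undirected. A graph is chordal if it has no induced cycle of length at least $4$. A graph $G$ is cycle extendible if for every non-Hamiltonian cycle $C$ of $G$ there is a cycle $C'$ with $V(C) \subset V(C')$ and $|V(C')| = |V(C)| + 1$; it is fully cycle extendible if it is cycle extendible and every vertex lies in a triangle. (Such a graph is a counterexample to Hendry's Conjecture, which asserts that every Hamiltonian chordal graph is fully cycle extendible.) *)

(* Defs.v *)
From mathcomp Require Import all_boot.

Set Implicit Arguments.
Unset Strict Implicit.
Unset Printing Implicit Defensive.

Record sgraph := SGraph {
  vertex :> finType;
  adj : rel vertex;
  adj_sym : symmetric adj;
  adj_irr : irreflexive adj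
}.

Arguments adj {s} x y.

Section Graphs.

Variable G : sgraph.
Implicit Types (c : seq G) (A X : {set G}) (x y z : G).

(* The adjacency of the induced subgraph G[A], as a relation on all of G. *)
Definition adj_in A : rel G := [rel x y | [&& x \in A, y \in A & adj x y]].

Definition connected_on A : bool :=
  (A != set0) && [forall x in A, forall y in A, connect (adj_in A) x y].

Definition connected : bool := connected_on [set: G].

Definition k_connected (k : nat) : bool :=
  (k < #|G|) && [forall X : {set G}, (#|X| < k) ==> connected_on (~: X)].

(* The greatest k such that G is k-connected. The bound on k loses nothing,
   as k_connected k implies k < #|G|; the connectivity of K_n is n - 1. *)
Definition connectivity : nat := \max_(k < #|G| | k_connected k) k.

(* A cycle of G, listed in cyclic order from any of its vertices; path.cycle
   alone also accepts the empty sequence and closed walks. *)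
Definition is_cycle c : bool := [&& 2 < size c, cycle adj c & uniq c].

Definition cycle_vertices c : {set G} := [set x in c].

Definition hamiltonian_cycle c : bool :=
  is_cycle c && (cycle_vertices c == [set: G]).

Definition hamiltonian : Prop := exists c, hamiltonian_cycle c.

Definition induced_cycle c : Prop :=
  is_cycle c /\
  {in c &, forall x y, adj x y -> y = next c x \/ y = prev c x}.

Definition chordal : Prop := ~ exists c, induced_cycle c /\ 4 <= size c.

Definition cycle_extendible : Prop :=
  forall c, is_cycle c -> ~~ hamiltonian_cycle c ->
  exists c', [/\ is_cycle c', cycle_vertices c \subset cycle_vertices c'
               & #|cycle_vertices c'| = #|cycle_vertices c|.+1].

Definition in_triangle x : Prop :=
  exists y z, [/\ adj x y, adj y z & adj z x].

Definition fully_cycle_extendible : Prop :=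
  cycle_extendible /\ forall x, in_triangle x.

End Graphs.

(* Main.v *)
Require Import Defs.
From mathcomp Require Import all_boot zify.

(* Let k = m + 1. The graph is the join of a clique on m + 1 vertices with the
   disjoint union of m isolated vertices and a chordal graph H. Fewer than m + 1
   deletions leave a vertex adjacent to everything, and deleting the clique
   disconnects the graph, so its connectivity is m + 1. A cycle through all
   clique vertices and isolated vertices is cut by the clique into at most m + 1
   arcs, m of which are used up by the isolated vertices, so it meets H in a
   single path; conversely every path of H closes up to such a cycle. Hence it
   suffices that H has a Hamiltonian path and a shorter path whose vertex set
   does not grow by exactly one vertex to that of another path. The graph
   base_graph on 16 vertices, obtained by computer search, is such an H: its
   Hamiltonian paths and the paths in question all run between the leaves 0 and
   1, and the degree-2 vertices 2, ..., 5 force so many edges that the remaining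
   possibilities are few. *)

Set Implicit Arguments.
Unset Strict Implicit.
Unset Printing Implicit Defensive.

(** * Chordality from a perfect elimination ordering *)

(** On an induced cycle of length at least 4, the two neighbours of the [r]-minimal vertex come
    later in the ordering, so they are adjacent and form a chord. *)
Lemma chordal_of_elimination (G : sgraph) (r : G -> nat) :
  injective r ->
  (forall x y z, r x < r y -> r x < r z -> adj x y -> adj x z -> y != z ->
   adj y z) ->
  chordal G.
Proof.
move=> r_inj elim [c [[/and3P[_ cyc_c uniq_c] ind_c] size_c]].
have [x0 x0c] : exists x, x \in c.
  by case: (c) size_c => // a l _; exists a; rewrite mem_head.
case: (arg_minnP r x0c) => x xc x_min.
have [i c' rot_c] := rot_to xc.
have r_lt y : y \in c -> y != x -> r x < r y.
  by move=> yc yx; rewrite ltn_neqAle x_min // andbT (inj_eq r_inj) eq_sym.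
move: cyc_c uniq_c size_c; rewrite -(rot_cycle i) -(rot_uniq i) -(size_rot i).
move=> cyc_c uniq_c size_c.
have mem_c : rot i c =i c by move=> y; rewrite mem_rot.
have next_c y : next (rot i c) y = next c y.
  by rewrite next_rot // -(rot_uniq i).
have prev_c y : prev (rot i c) y = prev c y.
  by rewrite prev_rot // -(rot_uniq i).
move: cyc_c uniq_c size_c mem_c next_c prev_c; rewrite rot_c {rot_c}.
(* The cycle reads x, y, w, ..., z. Length at least 4 makes [w] and [z] distinct, so [z] is neither
   the successor [w] nor the predecessor [x] of [y]. *)
case: c' => [|y [|w q]] //; case/lastP: q => // q z.
move=> cyc_c uniq_c _ mem_c next_c prev_c.
have yc : y \in c by rewrite -mem_c !inE eqxx orbT.
have zc : z \in c by rewrite -mem_c !inE mem_rcons mem_head !orbT.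
move: (uniq_c); rewrite /= !inE !mem_rcons !inE !negb_or.
case/and4P=> /and4P[xy xw xz xq] /and3P[yw yz yq] /andP[wz wq] _.
have prev_y : prev c y = x by rewrite -prev_c /= ?[y == x]eq_sym ?(negPf xy) ?eqxx.
have next_y : next c y = w by rewrite -next_c /= [y == x]eq_sym (negPf xy) eqxx.
move: cyc_c; rewrite /= rcons_path last_rcons => /andP[adj_xy].
case/andP=> _ /andP[_ adj_zx].
have adj_yz : adj y z.
  apply: (elim x); [| | exact: adj_xy | by rewrite adj_sym | exact: yz].
    by apply: r_lt; rewrite // eq_sym.
  by apply: r_lt; rewrite // eq_sym.
case: (ind_c y z yc zc adj_yz) => z_eq.
  by rewrite z_eq next_y eqxx in wz.
by rewrite z_eq prev_y eqxx in xz.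
Qed.

(** * A pruned search for paths with a prescribed end and vertex set *)

Section PathSearch.

Variables (T : eqType) (nb : T -> seq T) (t : T).
Let e : rel T := [rel x y | y \in nb x].
Hypothesis e_sym : symmetric e.

(* A vertex of degree at most 2 that is adjacent to the current end x of a path
   and is not the target must be visited immediately: otherwise it would have
   two neighbours on the rest of the path besides x. *)
Fixpoint path_search (n : nat) (R : seq T) (x : T) : bool :=
  if n is n'.+1 then
    has (fun y => [&& y \in R,
           all (fun z => [|| z == y, z == t, z \notin R | 2 < size (nb z)]) (nb x)
           & path_search n' (rem y R) y]) (nb x)
  else x == t.

(** Completeness of the search: its failure rules out every path from [x] to [t] whose remaining
    vertices are those of [R]. *)
Lemma path_searchP (p R : seq T) (x : T) :
  uniq (x :: p) -> path e x p -> last x p = t -> perm_eq p R ->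
  path_search (size p) R x.
Proof.
elim: p R x => [|y p IHp] R x /=; first by move=> _ _ -> _.
case/andP=> x_yp uniq_yp /andP[xy p_path] last_p perm_R.
apply/hasP; exists y => //; apply/and3P; split.
- by rewrite -(perm_mem perm_R) mem_head.
- apply/allP => z xz; rewrite -(perm_mem perm_R) inE.
  have [//|zy /=] := eqVneq z y; have [//|zt /=] := eqVneq z t.
  have [zp|//] := boolP (z \in p) => /=.
  (* As [z] is not the target, it has a successor [w] besides its predecessor [last y p1]; with [x]
     these are three distinct neighbours. *)
  case/splitPr: zp x_yp uniq_yp p_path last_p => p1 [|w p2].
    by rewrite last_cat /= => _ _ _ z_t; rewrite z_t eqxx in zt.
  rewrite cat_path /= => x_yp uniq_yp /and4P[_ uz zw _] _.
  have sub : {subset [:: x; last y p1; w] <= nb z}.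
    move=> v; rewrite !inE => /or3P[] /eqP ->; last by [].
      by rewrite -[_ \in nb z]/(e z x) e_sym; apply: xz.
    by rewrite -[_ \in nb z]/(e z (last y p1)) e_sym; apply: uz.
  apply: (uniq_leq_size _ sub) => /=.
  have u_in : last y p1 \in y :: p1 by apply: mem_last.
  have w_notin : w \notin y :: p1.
    move: (uniq_yp : uniq ((y :: p1) ++ [:: z, w & p2])); rewrite cat_uniq.
    by case/and3P=> _ /hasPn/(_ w) + _; apply; rewrite !inE eqxx orbT.
  move: (x_yp : x \notin (y :: p1) ++ [:: z, w & p2]).
  rewrite mem_cat !inE !negb_or.
  case/andP=> /andP[x_y x_p1] /and3P[_ xw _]; rewrite xw !andbT; apply/andP; split.
    by apply: contraTneq u_in => <-; rewrite inE negb_or x_y.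
  by apply: contraNneq w_notin => <-.
apply: IHp => //.
have := perm_to_rem (_ : y \in R); rewrite -(perm_mem perm_R) mem_head.
move/(_ isT) => perm_rem.
by rewrite -(perm_cons y) (perm_trans perm_R).
Qed.

(** An inner vertex of a path has a predecessor and a successor, which are distinct neighbours. *)
Lemma leaf_endpoint (x z : T) (p : seq T) :
  size (nb z) <= 1 -> uniq (x :: p) -> path e x p -> z \in x :: p ->
  z = x \/ z = last x p.
Proof.
move=> leaf; rewrite inE => + + /predU1P[|zp]; first by left.
case/splitPr: zp => p1 [|w p2]; first by rewrite last_cat; right.
rewrite cat_path /= => uniq_p /and4P[_ uz zw _].
have w_notin : w \notin x :: p1.
  move: (uniq_p : uniq ((x :: p1) ++ [:: z, w & p2])); rewrite cat_uniq.
  by case/and3P=> _ /hasPn/(_ w) + _; apply; rewrite !inE eqxx orbT.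
have: size [:: last x p1; w] <= size (nb z).
  apply: uniq_leq_size => [|v].
    by rewrite /= andbT inE; apply: contraNneq w_notin => <-; apply: mem_last.
  rewrite !inE => /orP[] /eqP -> //.
  by rewrite -[_ \in nb z]/(e z (last x p1)) e_sym; apply: uz.
by move/leq_trans/(_ leaf).
Qed.

End PathSearch.

(** * The join with a clique: chordality and connectivity *)

Lemma adj_in_sym (G : sgraph) (A : {set G}) : symmetric (adj_in A).
Proof. by move=> x y; rewrite /adj_in /= adj_sym andbCA. Qed.

Section CliqueJoin.

Variables (m : nat) (H : sgraph).

Definition join_adj : rel ('I_m.+1 + ('I_m + H)) := fun u v =>
  match u, v with
  | inl s, inl s' => s != s'
  | inl _, inr _ | inr _, inl _ => true
  | inr (inr g), inr (inr h) => adj g h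
  | inr _, inr _ => false
  end.

Lemma join_adj_sym : symmetric join_adj.
Proof. by case=> [s|[i|g]] [s'|[j|h]] //=; rewrite ?(eq_sym s) // adj_sym. Qed.

Lemma join_adj_irr : irreflexive join_adj.
Proof. by case=> [s|[i|g]] //=; rewrite ?eqxx // adj_irr. Qed.

Definition clique_join : sgraph := SGraph join_adj_sym join_adj_irr.

Let S (s : 'I_m.+1) : clique_join := inl s.
Let I (i : 'I_m) : clique_join := inr (inl i).
Let Hv (h : H) : clique_join := inr (inr h).

Let S_inj : injective S. Proof. by move=> s s' []. Qed.
Let I_inj : injective I. Proof. by move=> i j []. Qed.
Let Hv_inj : injective Hv. Proof. by move=> g h []. Qed.

(** Eliminate the isolated vertices first, whose neighbours all lie in the clique, then [H] in its
    own order, then the clique; the bound [b] places the clique above [H]. *)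
Lemma chordal_join (r : H -> nat) (b : nat) :
  injective r -> (forall h, r h < b) ->
  (forall x y z : H, r x < r y -> r x < r z -> adj x y -> adj x z -> y != z ->
   adj y z) ->
  chordal clique_join.
Proof.
move=> r_inj r_lt elim.
pose f (v : clique_join) := match v with
  | inl s => m + b + s | inr (inl i) => val i | inr (inr h) => m + r h end.
apply: (@chordal_of_elimination _ f).
  case=> [s|[i|g]] [s'|[j|h]] //=.
  - by move/addnI/val_inj->.
  - by have := ltn_ord j; lia.
  - by have := r_lt h; lia.
  - by have := ltn_ord i; lia.
  - by move/val_inj->.
  - by have := ltn_ord i; lia.
  - by have := r_lt g; lia.
  - by have := ltn_ord j; lia.
  - by move/addnI/r_inj->.
case=> [s|[i|x]] [s'|[j|y]] [s''|[l|z]] //=; rewrite ?(inj_eq S_inj) //.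
- by have := ltn_ord j; lia.
- by have := ltn_ord j; lia.
- by have := r_lt y; lia.
- by have := r_lt y; lia.
by rewrite !ltn_add2l (inj_eq Hv_inj); apply: elim.
Qed.

Lemma join_connected_on (X : {set clique_join}) (s : 'I_m.+1) :
  S s \notin X -> connected_on (~: X).
Proof.
move=> sX; apply/andP; split; first by apply/set0Pn; exists (S s); rewrite inE.
have to_s x : x \in ~: X -> connect (adj_in (~: X)) x (S s).
  move=> xX; have [->|xs] := eqVneq x (S s); first exact: connect0.
  apply: connect1; apply/and3P; split; [exact: xX | by rewrite inE |].
  case: x xs {xX} => [s' xs|w _]; [change (is_true (s' != s)) | by case: w].
  by apply: contraNneq xs => ->.
apply/'forall_implyP => x xX; apply/'forall_implyP => y yX.
apply: connect_trans (to_s x xX) _.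
by rewrite (sym_connect_sym (@adj_in_sym _ _)) to_s.
Qed.

Lemma connectivity_join : 0 < m -> 0 < #|H| -> connectivity clique_join = m.+1.
Proof.
move=> m_gt0 H_gt0; have /card_gt0P[h _] := H_gt0.
have card_join : m.+1 < #|clique_join|.
  by rewrite !card_sum !card_ord; lia.
apply/eqP; rewrite eqn_leq; apply/andP; split.
  apply/bigmax_leqP => k /andP[_ /forallP conn]; rewrite leqNgt; apply/negP => lt_k.
  have card_S : #|[set S s | s in 'I_m.+1]| = m.+1 by rewrite card_imset ?card_ord.
  have := conn [set S s | s in 'I_m.+1]; rewrite card_S lt_k /=.
  case/andP=> _ /'forall_implyP/(_ (I (Ordinal m_gt0))).
  have nS v : (v \in ~: [set S s | s in 'I_m.+1]) = (if v is inl _ then false else true).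
    rewrite inE; case: v => [s|w]; first by rewrite imset_f.
    by apply/imsetP => -[].
  rewrite nS => /(_ isT)/'forall_implyP/(_ (Hv h)); rewrite nS => /(_ isT).
  (* Once the clique is deleted, an isolated vertex has no neighbour left, so a path from it to [h]
     has no first step. *)
  case/connectP => -[//|v p /= /andP[/and3P[_ + adj_v] _] _].
  by rewrite nS; case: v adj_v => [|[]].
apply: (bigmax_sup (Ordinal card_join)) => //.
rewrite /k_connected card_join; apply/forallP => X; apply/implyP => card_X.
have /subsetPn[v /imsetP[s _ ->] sX] : ~~ ([set S s | s in 'I_m.+1] \subset X).
  apply: contraL card_X => /subset_leq_card.
  by rewrite card_imset // card_ord -leqNgt.
exact: join_connected_on sX.
Qed.

Lemma connected_join : connected clique_join.
Proof.
rewrite /connected -setC0; apply: (@join_connected_on _ ord0).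
by rewrite inE.
Qed.

(** * From paths of [H] to cycles of the join *)

Definition join_vertices (p : seq H) : {set clique_join} :=
  [set v | if v is inr (inr h) then h \in p else true].

(** The isolated vertices are paired with the clique vertices other than [S ord0], which is kept to
    precede the path of [H] in [join_cycle]. *)
Definition zigzag (l : seq 'I_m) : seq clique_join :=
  flatten [seq [:: S (lift ord0 i); I i] | i <- l].

Definition join_cycle (p : seq H) : seq clique_join :=
  S ord0 :: map Hv p ++ zigzag (enum 'I_m).

Lemma mem_zigzag l v :
  (v \in zigzag l) = match v with
    | inl s => s \in map (lift ord0) l
    | inr (inl i) => i \in l
    | inr (inr _) => false
  end.
Proof.
elim: l => [|i l IHl]; first by case: v => [s|[j|h]].
rewrite /zigzag /= !inE -/(zigzag l) IHl.
by case: v {IHl} => [s|[j|h]]; rewrite ?inE //= ?(inj_eq S_inj) ?(inj_eq I_inj).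
Qed.

Lemma uniq_zigzag l : uniq l -> uniq (zigzag l).
Proof.
elim: l => [//|i l IHl] /= /andP[i_l /IHl uniq_z].
rewrite -[flatten _]/(zigzag l) inE /= !mem_zigzag i_l uniq_z !andbT /=.
by rewrite mem_map //; apply: lift_inj.
Qed.

Lemma path_zigzag l (v : clique_join) :
  (if v is inl _ then false else true) -> path adj v (rcons (zigzag l) (S ord0)).
Proof.
elim: l v => [|i l IHl] v vS; first by case: v vS => [|[]].
rewrite -[zigzag _]/[:: S (lift ord0 i), I i & zigzag l] /=.
by apply/andP; split; [case: v vS => [|[]] | apply: IHl].
Qed.

Lemma join_cycleP (p : seq H) :
  0 < m -> p != [::] -> uniq p -> sorted adj p -> is_cycle (join_cycle p).
Proof.
move=> m_gt0; case: p => // h p _ uniq_p path_p.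
apply/and3P; split.
- rewrite /= size_cat addnC; have := mem_zigzag (enum 'I_m) (I (Ordinal m_gt0)).
  by rewrite /= mem_enum; case: (zigzag _).
- rewrite /join_cycle /= rcons_cat cat_path; apply/andP; split.
    by apply: homo_path path_p.
  by apply: path_zigzag; rewrite last_map.
rewrite /join_cycle cons_uniq cat_uniq map_inj_uniq // uniq_p uniq_zigzag ?enum_uniq //.
rewrite mem_cat mem_zigzag negb_or andbT /= -andbA; apply/and3P; split.
- by apply/(@mapP _ _ Hv (h :: p)) => -[].
- by apply/mapP => -[i _ /eqP]; rewrite (negPf (neq_lift _ _)).
apply/hasPn => -[s|[i|g]]; rewrite mem_zigzag // => _.
  by apply/(@mapP _ _ Hv (h :: p)) => -[].
by apply/(@mapP _ _ Hv (h :: p)) => -[].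
Qed.

Lemma join_cycle_vertices (p : seq H) :
  cycle_vertices (join_cycle p) = join_vertices p.
Proof.
apply/setP=> v; rewrite !inE mem_cat mem_zigzag.
case: v => [s|[i|h]] /=.
- have [j ->|->] := unliftP ord0 s; last by rewrite eqxx.
  by rewrite map_f ?orbT // mem_enum.
- by rewrite mem_enum !orbT.
by rewrite orbF mem_map.
Qed.

(** * From cycles of the join to paths of [H] *)

Let getH (v : clique_join) : option H := if v is inr (inr h) then Some h else None.
Let isS (v : clique_join) : bool := if v is inl _ then true else false.
(** The arcs of a cycle inside [H] are counted by their last vertices, since [H] can only be left
    into the clique. *)
Let exits (c : seq clique_join) : {set clique_join} :=
  [set v in c | getH v && isS (next c v)].

(* Each of the m.+1 clique vertices on a cycle has one predecessor, and the m
   isolated vertices already account for m of those predecessors. *)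
Lemma exits_unique (c : seq clique_join) u v :
  is_cycle c -> (forall i, I i \in c) -> u \in exits c -> v \in exits c -> u = v.
Proof.
case/and3P=> _ cyc_c uniq_c I_c u_ex v_ex; apply: contraTeq isT => uv.
pose A := [set I i | i in 'I_m] :|: [set u; v].
have next_A : next c @: A \subset [set S s | s in 'I_m.+1].
  apply/subsetP => _ /imsetP[w wA ->].
  suff: isS (next c w) by case: (next c w) => // s _; apply: imset_f.
  move: wA; rewrite !inE; case/or3P=> [/imsetP[i _ ->]|/eqP->|/eqP->].
  - by have := next_cycle cyc_c (I_c i); case: (next c _) => [|[]].
  - by move: u_ex; rewrite inE => /and3P[].
  - by move: v_ex; rewrite inE => /and3P[].
have := subset_leq_card next_A.
rewrite card_imset; last exact: can_inj (prev_next uniq_c).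
rewrite [#|[set S _ | _ in _]|]card_imset // card_ord cardsU.
rewrite card_imset // card_ord cards2 uv.
have -> : [set I i | i in 'I_m] :&: [set u; v] = set0.
  apply/setP => w; rewrite !inE; apply/negP => /andP[/imsetP[i _ ->]].
  by case/orP => /eqP eq; [move: u_ex | move: v_ex]; rewrite -eq inE andbF.
by rewrite cards0; lia.
Qed.

(** Without an exit, a cycle that meets [H] would stay in [H] all the way round and miss [S s]. *)
Lemma exits_neq0 (c : seq clique_join) h s :
  is_cycle c -> Hv h \in c -> S s \in c -> exits c != set0.
Proof.
case/and3P=> _ cyc_c uniq_c hc sc; apply: contraTneq sc => no_exit.
pose e := [rel u v : clique_join | getH u ==> getH v].
have: cycle e c.
  apply: cycle_from_next => // v vc /=; apply/implyP => Hv_v.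
  have := next_cycle cyc_c vc; have: v \notin exits c by rewrite no_exit inE.
  rewrite inE vc Hv_v /=; case: v Hv_v {vc} => [|[]] //= g _.
  by case: (next c _) => [|[]].
have [i c' rot_c] := rot_to hc; rewrite -(rot_cycle i) -(mem_rot i) rot_c inE /=.
suff all_H q v : getH v -> path e v (rcons q (Hv h)) -> S s \notin q.
  by move/(all_H _ (Hv h) isT).
elim: q v => [//|w q IHq] v Hv_v /= /andP[/implyP/(_ Hv_v) Hv_w path_q].
by rewrite inE negb_or (IHq w) // andbT; case: w Hv_w {path_q}.
Qed.

(** Read from just after its unique exit [x] round to [x], the cycle never leaves [H] once it has
    entered it. Its vertices in [H] thus form a final segment, which is a path. *)
Lemma join_cycle_trace (c : seq clique_join) :
  is_cycle c -> (forall s, S s \in c) -> (forall i, I i \in c) ->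
  (exists h, Hv h \in c) ->
  exists t : seq H,
    [/\ uniq t, sorted adj t & forall h, (h \in t) = (Hv h \in c)].
Proof.
move=> cyc_c S_c I_c [h hc].
have [x x_ex] := set0Pn _ (exits_neq0 cyc_c hc (S_c ord0)).
have exit_x v : v \in exits c -> v = x by move=> v_ex; apply: exits_unique v_ex x_ex.
have [_ cyc uniq_c] := and3P cyc_c.
move: x_ex; rewrite inE => /and3P[xc Hx _].
have [i c' rot_c] := rot_to xc.
pose e := [rel u v : clique_join | adj u v && ((u != x) && getH u ==> getH v)].
have: cycle e c.
  apply: cycle_from_next => // v vc /=; rewrite next_cycle //=.
  apply/implyP => /andP[vx Hv_v]; have := next_cycle cyc vc.
  have: v \notin exits c by apply: contraNN vx => /exit_x->.
  rewrite inE vc Hv_v /=; case: v Hv_v {vc vx} => [|[]] //= g _.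
  by case: (next c _) => [|[]].
rewrite -(rot_cycle i) rot_c /= => path_e.
have perm_c : perm_eq (rcons c' x) c by rewrite perm_rcons -rot_c perm_rot.
have getHK : ocancel getH Hv by case=> [|[]].
exists (pmap getH (rcons c' x)); split.
- by rewrite (pmap_uniq getHK) // (perm_uniq perm_c).
- have x_c' : x \notin c'.
    by move: uniq_c; rewrite -(perm_uniq perm_c) rcons_uniq => /andP[].
  have sorted_e : sorted e (rcons c' x) by apply: path_sorted path_e.
  (* If [v] lies in [H], so does its successor, because [v] is not [x]; that successor is therefore
     the next entry kept by [pmap]. *)
  elim: c' {rot_c path_e perm_c} x_c' sorted_e => [|v q IHq] /=.
    by case: (getH x).
  rewrite inE negb_or => /andP[xv x_q] path_e.
  have IH := IHq x_q (path_sorted path_e).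
  case Hv_v: (getH v) => [g|] //=.
  case: q path_e {IHq x_q} IH => [|w q] /=; rewrite eq_sym xv /= Hv_v /=.
    by case: v {xv} Hv_v => [|[]] // _ [->]; case: (x) Hx => [|[]] //= y _ /andP[].
  case/andP=> /andP[vw Hv_w] _; case: v {xv} Hv_v vw => [|[]] // _ [->].
  by case: w Hv_w => [|[]] // k _ /= ->.
move=> g; rewrite (can2_mem_pmap getHK) ?(perm_mem perm_c) //.
Qed.

(** The cycle built from [p] misses only vertices of [H], so an extension adds one such vertex [h],
    and its trace in [H] would be a path on [h :: p]. *)
Lemma join_not_cycle_extendible (p : seq H) (h0 : H) :
  0 < m -> p != [::] -> uniq p -> sorted adj p -> h0 \notin p ->
  (forall h t, h \notin p -> uniq t -> sorted adj t -> ~ t =i h :: p) ->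
  ~ cycle_extendible clique_join.
Proof.
move=> m_gt0 p_n0 uniq_p path_p h0_p no_ext ext.
have [|c [cyc_c]] := ext _ (join_cycleP m_gt0 p_n0 uniq_p path_p).
  rewrite negb_and orbC join_cycle_vertices; apply/orP; left.
  by apply: contraNneq h0_p => /setP/(_ (Hv h0)); rewrite !inE.
rewrite join_cycle_vertices => sub card_c.
have /cards1P[x x_eq] : #|cycle_vertices c :\: join_vertices p| == 1.
  by rewrite cardsD (setIidPr sub) card_c subSnn.
have sub_c v : v \in join_vertices p -> v \in c by move/(subsetP sub); rewrite inE.
have mem_c v : (v \in c) = (v \in join_vertices p) || (v == x).
  have: (v \in cycle_vertices c :\: join_vertices p) = (v == x) by rewrite x_eq inE.
  rewrite in_setD [v \in cycle_vertices c]inE => <-.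
  by case: (boolP (v \in join_vertices p)) => // /sub_c.
have [t [uniq_t path_t mem_t]] : exists t : seq H,
    [/\ uniq t, sorted adj t & forall h, (h \in t) = (Hv h \in c)].
  apply: join_cycle_trace => // [s|i|]; try by apply: sub_c; rewrite inE.
  case: (p) p_n0 sub_c => // h q _ sub_c; exists h.
  by apply: sub_c; rewrite inE /= mem_head.
have : x \in [set x] by rewrite inE.
rewrite -x_eq inE => /andP[]; rewrite inE.
case: x x_eq mem_c => [//|[//|h]] _ mem_c h_p _.
apply: (no_ext h t) => // g; rewrite mem_t mem_c !inE orbC.
by rewrite (inj_eq Hv_inj).
Qed.

Lemma hamiltonian_join (q : seq H) :
  0 < m -> q != [::] -> uniq q -> sorted adj q -> q =i predT ->
  hamiltonian clique_join.
Proof.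
move=> m_gt0 q_n0 uniq_q path_q mem_q; exists (join_cycle q).
rewrite /hamiltonian_cycle join_cycleP //= join_cycle_vertices.
by apply/eqP/setP => -[s|[i|h]]; rewrite !inE ?mem_q.
Qed.

End CliqueJoin.

(** * The base graph and its non-extendible path *)

(* The list at position i is the set of neighbours of i above i; it is a clique,
   so that 0, 1, ..., 15 is a perfect elimination ordering. *)
Definition upper_nbrs : seq (seq nat) :=
  [:: [:: 11]; [:: 8]; [:: 9; 12]; [:: 7; 11]; [:: 6; 12]; [:: 10; 13];
      [:: 8; 12; 13]; [:: 9; 11; 13]; [:: 11; 12; 13; 14]; [:: 10; 11; 12; 13];
      [:: 11; 12; 13; 15]; [:: 12; 13; 14; 15]; [:: 13; 14; 15]; [:: 14; 15];
      [:: 15]; [::]].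

Definition base_rel : rel nat := fun i j =>
  (j \in nth [::] upper_nbrs i) || (i \in nth [::] upper_nbrs j).

Lemma base_rel_sym : symmetric base_rel.
Proof. by move=> i j; rewrite /base_rel orbC. Qed.

Lemma base_rel_irr (i : 'I_16) : base_rel i i = false.
Proof.
have /allP/(_ i) : all (fun i => ~~ base_rel i i) (iota 0 16) by vm_compute.
by rewrite mem_iota ltn_ord => /(_ isT)/negPf.
Qed.

Definition base_adj : rel 'I_16 := fun i j => base_rel i j.

Lemma base_adj_sym : symmetric base_adj.
Proof. by move=> i j; apply: base_rel_sym. Qed.

Definition base_graph : sgraph := SGraph base_adj_sym base_rel_irr.

Lemma base_elimination (x y z : base_graph) :
  val x < val y -> val x < val z -> adj x y -> adj x z -> y != z -> adj y z.
Proof.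
pose P i j k := [&& i < j, i < k, base_rel i j, base_rel i k & j != k] ==>
  base_rel j k.
have: all (fun i => all (fun j => all (P i j) (iota 0 16)) (iota 0 16)) (iota 0 16).
  by vm_compute.
move=> /allP/(_ (val x)); rewrite mem_iota ltn_ord => /(_ isT).
move=> /allP/(_ (val y)); rewrite mem_iota ltn_ord => /(_ isT).
move=> /allP/(_ (val z)); rewrite mem_iota ltn_ord => /(_ isT) /implyP Pxyz.
by move=> xy xz adj_xy adj_xz yz; apply: Pxyz; apply/and5P.
Qed.

(** The test [i < 16] puts [i] on the same footing as [j], so the relation is symmetric on all of
    [nat], as the path search requires. *)
Definition base_nbrs (i : nat) : seq nat :=
  [seq j <- iota 0 16 | (i < 16) && base_rel i j].

Lemma mem_base_nbrs (i j : base_graph) : (val j \in base_nbrs (val i)) = adj i j.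
Proof. by rewrite mem_filter mem_iota !ltn_ord !andbT. Qed.

Lemma base_nbrs_sym : symmetric [rel i j | j \in base_nbrs i].
Proof.
move=> i j; rewrite /= !mem_filter !mem_iota !add0n /= base_rel_sym.
by rewrite -!andbA andbC -andbA [RHS]andbCA.
Qed.

(** A path between the leaves 0 and 1 that misses exactly 14 and 15. *)
Definition short_path : seq nat := [:: 0; 11; 3; 7; 13; 5; 10; 9; 2; 12; 4; 6; 8; 1].

Definition long_path : seq nat :=
  [:: 0; 11; 3; 7; 9; 2; 12; 4; 6; 13; 5; 10; 15; 14; 8; 1].

(** The fuel 14 is the number of vertices still to be visited after 0: [v] and the 13 others of
    [short_path]. *)
Lemma short_path_search (v : nat) :
  v \in [:: 14; 15] ->
  ~~ path_search base_nbrs 1 14 (v :: behead short_path) 0.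
Proof.
have: all (fun v => ~~ path_search base_nbrs 1 14 (v :: behead short_path) 0)
  [:: 14; 15].
  (* Under vm_compute both sides of && are evaluated, so nothing is pruned. *)
  by lazy.
by move/allP; apply.
Qed.

(** The leaves 0 and 1 must be the two ends, so up to reversal the path runs from 0 to 1, which the
    failed search excludes. *)
Lemma short_path_maximal (v : nat) (t : seq nat) :
  v \in [:: 14; 15] -> uniq t -> sorted [rel i j | j \in base_nbrs i] t ->
  ~ perm_eq t (v :: short_path).
Proof.
move=> v_in.
have no_path x p : uniq (x :: p) -> path [rel i j | j \in base_nbrs i] x p ->
    perm_eq (x :: p) (v :: short_path) -> x = 0 -> last x p = 1 -> False.
  move=> uniq_p path_p perm_p x0 last_p; subst x.
  have perm_p' : perm_eq p (v :: behead short_path).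
    rewrite -(perm_cons 0) (perm_trans perm_p) //.
    exact: (permEl (perm_catCA [:: v] [:: 0] (behead short_path))).
  have := path_searchP base_nbrs_sym uniq_p path_p last_p perm_p'.
  rewrite (perm_size perm_p').
  by apply/negP; apply: short_path_search.
case: t => [|x p] uniq_p path_p perm_p; first by have := perm_size perm_p.
have in_p i : i \in short_path -> i \in x :: p.
  by move=> i_in; rewrite (perm_mem perm_p) inE i_in orbT.
have [x0|l0] := leaf_endpoint (z := 0) base_nbrs_sym isT uniq_p path_p (in_p 0 isT).
all: have [x1|l1] := leaf_endpoint (z := 1) base_nbrs_sym isT uniq_p path_p (in_p 1 isT).
- by rewrite -x0 in x1.
- exact: (no_path x p).
(* Here the path runs from 1 to 0 and is reversed. *)
- have rev_p : rev (x :: p) = last x p :: rev (belast x p).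
    by rewrite lastI rev_rcons.
  apply: (no_path (last x p) (rev (belast x p))); rewrite -?rev_p ?rev_uniq //.
  - rewrite rev_path (eq_path (e' := [rel i j | j \in base_nbrs i])) // => i j.
    exact: base_nbrs_sym.
  - by rewrite (perm_trans _ perm_p) // perm_rev.
  by case: (p) {rev_p} x1 => [|y q] //= x1; rewrite rev_cons last_rcons.
by rewrite -l0 in l1.
Qed.

(** * Assembly of the counterexample *)

Theorem theorem3p4 (k : nat) (hk : 2 <= k) :
  exists G : sgraph,
    [/\ connected G, hamiltonian G, chordal G, connectivity G = k
      & ~ fully_cycle_extendible G].
Proof.
case: k hk => [//|m]; rewrite ltnS => m_gt0.
(* Lists of numbers below 16 are carried over to vertices, so that their properties are computed on
   [nat]. *)
pose ords (s : seq nat) : seq base_graph := map inord s.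
have ordsK s : all (fun i => i < 16) s -> map val (ords s) = s.
  by move/allP=> s_lt; rewrite -map_comp map_id_in // => i /s_lt; apply: inordK.
have uniq_ords s : all (fun i => i < 16) s -> uniq s -> uniq (ords s).
  by move=> s_lt; rewrite -{1}(ordsK s s_lt) (map_inj_uniq val_inj).
have sorted_ords s : all (fun i => i < 16) s -> sorted base_rel s ->
    sorted adj (ords s).
  by move=> s_lt; rewrite -{1}(ordsK s s_lt) sorted_map.
have mem_ords s (i : base_graph) : all (fun i => i < 16) s ->
    (i \in ords s) = (val i \in s).
  by move=> s_lt; rewrite -{2}(ordsK s s_lt) (mem_map val_inj).
exists (clique_join m base_graph); split.
- exact: connected_join.
- apply: (@hamiltonian_join _ _ (ords long_path)) => //.
  + exact: uniq_ords.
  + exact: sorted_ords.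
  move=> i; rewrite mem_ords //; have := ltn_ord i; rewrite -[_ < _](mem_iota 0 16).
  by apply: (allP (_ : all (mem long_path) (iota 0 16))).
- apply: (@chordal_join m base_graph val 16) base_elimination; first exact: val_inj.
  exact: ltn_ord.
- by apply: connectivity_join; rewrite ?card_ord.
case=> ext _; move: ext.
(* Vertex 14 is off [short_path], which makes the cycle built from it non-Hamiltonian. *)
apply: (@join_not_cycle_extendible _ _ (ords short_path) (inord 14)) => //.
- exact: uniq_ords.
- exact: sorted_ords.
- by rewrite mem_ords //; set v := val _; have -> : v = 14 by exact: inordK.
move=> h t; rewrite mem_ords // => h_out uniq_t path_t mem_t.
apply: (@short_path_maximal (val h) (map val t)).
- have /allP/(_ (val h)) :
    all (fun i => (i \notin short_path) ==> (i \in [:: 14; 15])) (iota 0 16) by [].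
  by rewrite mem_iota ltn_ord => /(_ isT)/implyP; apply.
- by rewrite (map_inj_uniq val_inj).
- by apply: homo_sorted path_t => i j; rewrite /= mem_base_nbrs.
apply: (perm_trans (perm_map val (uniq_perm uniq_t _ mem_t))).
  by rewrite cons_uniq mem_ords // h_out uniq_ords.
by rewrite map_cons ordsK.
Qed.
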